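(* Let $A\in\mathbb{R}^{m\times p}$ (with no zero rows), $B\in\mathbb{R}^{q\times n}$ and $C\in\mathbb{R}^{m\times n}$ be such that the matrix equation $AXB=C$ is consistent, and let $\theta\in[0,1]$. If $0<\alpha<\frac{2}{\|B\|^2}$, then the sequence $\{X^k\}_{k=0}^\infty$ obtained by the relaxed greedy randomized block Kaczmarz (RGRBK) method with parameter $\theta$ (defined in the context) converges in expectation to a solution of $AXB=C$. If $\mathrm{range}(X^0)\subseteq\mathrm{range}(A^T)$ and $\mathrm{range}((X^0)^T)\subseteq\mathrm{range}(B)$, then the RGRBK method converges in expectation to the unique minimum norm solution $X_*=A^+CB^+$. Moreover, in this case the solution error satisfies $$\mathbb{E}_k\big[\|X^{k+1}-X_*\|_F^2\big]\le\delta_{k,\theta}\cdot\|X^k-X_*\|_F^2\le\delta\cdot\|X^k-X_*\|_F^2 .$$ As a result, $$\mathbb{E}\big[\|X^{k+1}-X_*\|_F^2\big]\le\prod_{\ell=0}^k\delta_{\ell,\theta}\cdot\|X^0-X_*\|_F^2\le\delta^{k+1}\cdot\|X^0-X_*\|_F^2 .$$ Here $\delta_{k,\theta}$ and $\delta$ are defined in the context.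
   Context: $M_{i,:}$ denotes the $i$th row of a matrix $M$, $A_{i,:}^T$ the transpose of the $i$th row of $A$, $\|\cdot\|$ the 2-norm (spectral norm for matrices), $\|\cdot\|_F$ the Frobenius norm, $M^+$ the Moore--Penrose pseudoinverse, $\mathrm{range}(M)$ the column space, $\sigma_{\min}(M)$ the smallest singular value, $[m]=\{1,\dots,m\}$. The equation is consistent if it has at least one solution; the minimum norm solution is the solution of smallest Frobenius norm. $\mathbb{E}_k[\cdot]=\mathbb{E}[\,\cdot\mid i_0,\dots,i_{k-1}]$ is the expectation conditional on the first $k$ iterations, $i_j$ being the row index selected at iteration $j$. Convergence in expectation of $X^k$ to $Y$ means $\mathbb{E}[\|X^k-Y\|_F^2]\to0$. RGRBK method (initial guess $X^0\in\mathbb{R}^{p\times q}$, parameters $\alpha$ and $\theta\in[0,1]$): set $R^0=C-AX^0B$. For $k=0,1,2,\dots$: let $$\xi_k=\theta\cdot\max_{1\le i\le m}\tfrac{\|R^k_{i,:}\|^2}{\|A_{i,:}\|^2}+(1-\theta)\cdot\tfrac{\|R^k\|_F^2}{\|A\|_F^2},\qquad \mathcal{H}_k=\{i:\ \|R^k_{i,:}\|^2\ge\xi_k\|A_{i,:}\|^2\};$$ let $\widetilde R^k$ have rows $\widetilde R^k_{i,:}=R^k_{i,:}$ if $i\in\mathcal{H}_k$ and $\widetilde R^k_{i,:}=0$ otherwise; choose $i_k\in\mathcal{H}_k$ with probability $\|\widetilde R^k_{i_k,:}\|^2/\|\widetilde R^k\|_F^2$; update $$X^{k+1}=X^k+\tfrac{\alpha}{\|A_{i_k,:}\|^2}A_{i_k,:}^T\,(R^k_{i_k,:}B^T),\qquad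 R^{k+1}=R^k-\tfrac{\alpha}{\|A_{i_k,:}\|^2}\,(AA_{i_k,:}^T)\,(R^k_{i_k,:}B^TB),$$ so that $R^k=C-AX^kB$. Standing assumption: at each iteration $k$, the ratios $\|R^k_{i,:}\|^2/\|A_{i,:}\|^2$, $i\in[m]$, are not all equal. Define $$\Omega_k=\Big\{i:\ \tfrac{\|R^k_{i,:}\|^2}{\|A_{i,:}\|^2}<\tfrac1m\sum_{j\in[m]}\tfrac{\|R^k_{j,:}\|^2}{\|A_{j,:}\|^2}\Big\},$$ and let $\varepsilon\in(0,1)$ (depending on $k$) be defined by $\frac1m\sum_{i\in[m]}\frac{\|R^k_{i,:}\|^2}{\|A_{i,:}\|^2}=\varepsilon\cdot\max_{1\le i\le m}\frac{\|R^k_{i,:}\|^2}{\|A_{i,:}\|^2}$. Let $$\varphi_{k,\theta}=\theta\cdot\frac{1}{\sum_{i\in[m]\setminus\Omega_k}\|A_{i,:}\|^2+\varepsilon\sum_{i\in\Omega_k}\|A_{i,:}\|^2}+(1-\theta)\cdot\frac1{\|A\|_F^2},$$ $$\delta_{k,\theta}=1-(2\alpha-\alpha^2\|B\|^2)\,\varphi_{k,\theta}\,\sigma_{\min}^2(A)\,\sigma_{\min}^2(B),\qquad \delta=1-\frac{2\alpha-\alpha^2\|B\|^2}{\|A\|_F^2}\,\sigma_{\min}^2(A)\,\sigma_{\min}^2(B).$$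
   Formalization: In the last display the factors δ_{ℓ,θ} are random (they depend on the selected rows), and the bound can fail along a path of positive probability; the product is therefore replaced by its expectation E[∏ δ_{ℓ,θ}]. *)

(* Defs.v *)
From mathcomp Require Import all_boot all_order all_algebra.
From mathcomp Require Import all_classical all_reals all_analysis.

Set Implicit Arguments.
Unset Strict Implicit.
Unset Printing Implicit Defensive.

Import Order.TTheory GRing.Theory Num.Theory.
Import numFieldNormedType.Exports.

Local Open Scope classical_set_scope.
Local Open Scope ring_scope.

(* On a one-row or one-column matrix this is the Euclidean norm. *)
Definition frobenius {R : realType} {m n : nat} (M : 'M[R]_(m, n)) : R :=
  Num.sqrt (\sum_(i < m) \sum_(j < n) M i j ^+ 2).

Definition spectral_norm {R : realType} {m n : nat} (M : 'M[R]_(m, n)) : R :=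
  sup [set frobenius (M *m v) | v in [set v : 'cV[R]_n | frobenius v <= 1]].

(* With both equations, the singular values of an m x n matrix are exactly the
   min(m, n) usual ones: 0 is one of them iff M is rank deficient. *)
Definition singular_value {R : realType} {m n : nat} (M : 'M[R]_(m, n))
    (s : R) : Prop :=
  0 <= s /\ exists (u : 'cV[R]_m) (v : 'cV[R]_n),
    [/\ frobenius u = 1, frobenius v = 1,
        M *m v = s *: u & M^T *m u = s *: v].

Definition sigma_min {R : realType} {m n : nat} (M : 'M[R]_(m, n)) : R :=
  inf [set s | singular_value M s].

Definition penrose {R : realType} {m n : nat} (M : 'M[R]_(m, n))
    (G : 'M[R]_(n, m)) : Prop :=
  [/\ M *m G *m M = M, G *m M *m G = G,
      (M *m G)^T = M *m G & (G *m M)^T = G *m M].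

(* Moore-Penrose pseudoinverse: the unique solution of the Penrose equations.
   MathComp's pinvmx is only a partial inverse. *)
Definition mp_pinv {R : realType} {m n : nat} (M : 'M[R]_(m, n)) :
    'M[R]_(n, m) :=
  xget 0 [set G | penrose M G].

(* Inclusion of column spaces; (_ <= _)%MS compares row spaces. *)
Definition range_sub {R : realType} {m n p : nat} (M : 'M[R]_(m, n))
    (N : 'M[R]_(m, p)) : Prop :=
  (M^T <= N^T)%MS.

Definition is_solution {R : realType} {m p q n : nat} (A : 'M[R]_(m, p))
    (B : 'M[R]_(q, n)) (C : 'M[R]_(m, n)) (X : 'M[R]_(p, q)) : Prop :=
  A *m X *m B = C.

Definition unique_min_norm_solution {R : realType} {m p q n : nat}
    (A : 'M[R]_(m, p)) (B : 'M[R]_(q, n)) (C : 'M[R]_(m, n))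
    (X : 'M[R]_(p, q)) : Prop :=
  is_solution A B C X /\
  forall Y : 'M[R]_(p, q), is_solution A B C Y -> Y <> X ->
    frobenius X < frobenius Y.

Definition row_ratio {R : realType} {m p n : nat} (A : 'M[R]_(m, p))
    (Rk : 'M[R]_(m, n)) (i : 'I_m) : R :=
  frobenius (row i Rk) ^+ 2 / frobenius (row i A) ^+ 2.

(* The ratios are nonnegative, so 0 is a harmless default for the maximum. *)
Definition max_ratio {R : realType} {m p n : nat} (A : 'M[R]_(m, p))
    (Rk : 'M[R]_(m, n)) : R :=
  \big[Num.max/0]_(i < m) row_ratio A Rk i.

Definition mean_ratio {R : realType} {m p n : nat} (A : 'M[R]_(m, p))
    (Rk : 'M[R]_(m, n)) : R :=
  m%:R^-1 * \sum_(i < m) row_ratio A Rk i.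

Definition xi {R : realType} {m p n : nat} (theta : R) (A : 'M[R]_(m, p))
    (Rk : 'M[R]_(m, n)) : R :=
  theta * max_ratio A Rk
  + (1 - theta) * (frobenius Rk ^+ 2 / frobenius A ^+ 2).

Definition greedy_rows {R : realType} {m p n : nat} (theta : R)
    (A : 'M[R]_(m, p)) (Rk : 'M[R]_(m, n)) : pred 'I_m :=
  fun i => xi theta A Rk * frobenius (row i A) ^+ 2 <=
           frobenius (row i Rk) ^+ 2.

Definition greedy_residual {R : realType} {m p n : nat} (theta : R)
    (A : 'M[R]_(m, p)) (Rk : 'M[R]_(m, n)) : 'M[R]_(m, n) :=
  \matrix_(i, j) (if greedy_rows theta A Rk i then Rk i j else 0).

Definition selection_prob {R : realType} {m p n : nat} (theta : R)
    (A : 'M[R]_(m, p)) (Rk : 'M[R]_(m, n)) (i : 'I_m) : R :=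
  frobenius (row i (greedy_residual theta A Rk)) ^+ 2
  / frobenius (greedy_residual theta A Rk) ^+ 2.

(* The pair (X^k, R^k) reached from X^0 by selecting row s j at iteration j. *)
Fixpoint rgrbk_state {R : realType} {m p q n : nat} (alpha : R)
    (A : 'M[R]_(m, p)) (B : 'M[R]_(q, n)) (C : 'M[R]_(m, n))
    (X0 : 'M[R]_(p, q)) (s : nat -> 'I_m) (k : nat) :
    'M[R]_(p, q) * 'M[R]_(m, n) :=
  if k is j.+1 then
    let: (X, Rj) := rgrbk_state alpha A B C X0 s j in
    let a := row (s j) A in
    let r := row (s j) Rj in
    let c := alpha / frobenius a ^+ 2 in
    (X + c *: (a^T *m (r *m B^T)),
     Rj - c *: ((A *m a^T) *m (r *m B^T *m B)))
  else (X0, C - A *m X0 *m B).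

(* Random iterates: row selections are random indices I 0, I 1, ... on T. *)
Definition iterate {R : realType} {m p q n : nat} {T : Type} (alpha : R)
    (A : 'M[R]_(m, p)) (B : 'M[R]_(q, n)) (C : 'M[R]_(m, n))
    (X0 : 'M[R]_(p, q)) (I : nat -> T -> 'I_m) (k : nat) (w : T) :
    'M[R]_(p, q) :=
  (rgrbk_state alpha A B C X0 (fun j => I j w) k).1.

Definition residual {R : realType} {m p q n : nat} {T : Type} (alpha : R)
    (A : 'M[R]_(m, p)) (B : 'M[R]_(q, n)) (C : 'M[R]_(m, n))
    (X0 : 'M[R]_(p, q)) (I : nat -> T -> 'I_m) (k : nat) (w : T) :
    'M[R]_(m, n) :=
  (rgrbk_state alpha A B C X0 (fun j => I j w) k).2.

Definition past {m : nat} {T : Type} (I : nat -> T -> 'I_m) (k : nat) (w : T) :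
    set T :=
  [set w' | forall j, (j < k)%N -> I j w' = I j w].

(* E[Y | I 0, ..., I k.-1]: the conditioning variables take finitely many
   values, so this is the elementary conditional expectation. It is meaningful
   on atoms of positive probability, hence almost surely. *)
Definition cond_expectation {d : measure_display} {T : measurableType d}
    {R : realType} (P : probability T R) {m : nat} (I : nat -> T -> 'I_m)
    (k : nat) (Y : T -> R) (w : T) : \bar R :=
  ('E_P[fun w' => (Y w' * \1_(past I k w) w')%R]
   * ((fine (P (past I k w)))^-1)%:E)%E.

Definition rgrbk_selection {d : measure_display} {T : measurableType d}
    {R : realType} (P : probability T R) {m p q n : nat} (theta alpha : R)
    (A : 'M[R]_(m, p)) (B : 'M[R]_(q, n)) (C : 'M[R]_(m, n))
    (X0 : 'M[R]_(p, q)) (I : nat -> T -> 'I_m) : Prop :=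
  (forall k i, measurable (I k @^-1` [set i])) /\
  (forall k i, {ae P, forall w,
     cond_expectation P I k \1_(I k @^-1` [set i]) w
     = (selection_prob theta A (residual alpha A B C X0 I k w) i)%:E}).

Definition cvg_in_expectation {d : measure_display} {T : measurableType d}
    {R : realType} (P : probability T R) {p q : nat}
    (X : nat -> T -> 'M[R]_(p, q)) (Y : 'M[R]_(p, q)) : Prop :=
  'E_P[fun w => (frobenius (X k w - Y) ^+ 2)%R]%E @[k --> \oo] --> 0%E.

Definition below_mean {R : realType} {m p n : nat} (A : 'M[R]_(m, p))
    (Rk : 'M[R]_(m, n)) : pred 'I_m :=
  fun i => row_ratio A Rk i < mean_ratio A Rk.

Definition epsilon {R : realType} {m p n : nat} (A : 'M[R]_(m, p))
    (Rk : 'M[R]_(m, n)) : R :=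
  mean_ratio A Rk / max_ratio A Rk.

Definition phi {R : realType} {m p n : nat} (theta : R) (A : 'M[R]_(m, p))
    (Rk : 'M[R]_(m, n)) : R :=
  theta * (\sum_(i < m | ~~ below_mean A Rk i) frobenius (row i A) ^+ 2
           + epsilon A Rk
             * \sum_(i < m | below_mean A Rk i) frobenius (row i A) ^+ 2)^-1
  + (1 - theta) * (frobenius A ^+ 2)^-1.

Definition delta_step {R : realType} {m p q n : nat} (theta alpha : R)
    (A : 'M[R]_(m, p)) (B : 'M[R]_(q, n)) (Rk : 'M[R]_(m, n)) : R :=
  1 - (2 * alpha - alpha ^+ 2 * spectral_norm B ^+ 2) * phi theta A Rk
      * sigma_min A ^+ 2 * sigma_min B ^+ 2.

Definition delta {R : realType} {m p q n : nat} (alpha : R)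
    (A : 'M[R]_(m, p)) (B : 'M[R]_(q, n)) : R :=
  1 - (2 * alpha - alpha ^+ 2 * spectral_norm B ^+ 2) / frobenius A ^+ 2
      * sigma_min A ^+ 2 * sigma_min B ^+ 2.

(* Main.v *)
Require Import Defs.
From mathcomp Require Import all_boot all_order all_algebra.
From mathcomp Require Import all_classical all_reals all_analysis.
From mathcomp Require Import measurable_realfun ring lra.

Set Implicit Arguments.
Unset Strict Implicit.
Unset Printing Implicit Defensive.

Import Order.TTheory GRing.Theory Num.Theory.
Import numFieldNormedType.Exports.

Local Open Scope classical_set_scope.
Local Open Scope ring_scope.

(** Every admissible row of the method, not just the average one, decreases the
error by the stated factor. The contraction therefore holds pathwise, which is
why the random factors can be multiplied although they are correlated with the
errors.

Let [D = X^k - Y] for a solution [Y]. The residual is [R = - A D B], and the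
cross term of the updated squared error is [- 2 alpha |r|^2 / |a|^2] for the
selected rows [r] of [R] and [a] of [A], while the quadratic term is at most
[alpha^2 |B|^2 |r|^2 / |a|^2]. Hence the step gains at least
[(2 alpha - alpha^2 |B|^2) |r|^2 / |a|^2] ([kaczmarz_step_error]). The greedy
rule forces [|r|^2 / |a|^2 >= xi], and splitting [|R|^2] along the rows below
and above the mean ratio gives [xi >= phi |R|^2] ([phi_residual_le_xi]).

It remains to bound [|A D B|] below by [|D|]. If the columns of [D] lie in the
row space of [A] and its rows in the column space of [B], a property the updates
preserve, two bounds apply. One uses the smallest singular values and yields
[delta_step] ([sigma_min_residual_bound]); it is vacuous when one of them is
zero. The other uses [D = A^+ (A D B) B^+] and always yields a factor below one
([in_row_col_space_le], [uniform_rate_lt1]), hence convergence without any rank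
condition. For a general starting point the limit is
[A^+ C B^+ + X0 - A^+ A X0 B B^+], because the component of [X0] which
[A _ B] annihilates never changes.

Probability enters in two ways. A row outside the greedy set has conditional
probability zero on every history of positive probability, so almost surely all
the selected rows are greedy ([ae_greedy]). And every quantity of iteration [k]
is a function of the finitely many possible histories, hence measurable and
bounded, so that almost sure inequalities integrate. Since the error never
vanishes, the pathwise inequality also shows [delta_step >= 0], which is what
lets the one-step factors be multiplied ([ae_product_bounds]). *)

(** * Frobenius inner product *)

Definition fdot {R : realType} {m n : nat} (M N : 'M[R]_(m, n)) : R :=
  \tr (M^T *m N).

Section Fdot.
Context {R : realType}.

Lemma fdotE m n (M N : 'M[R]_(m, n)) :
  fdot M N = \sum_(i < m) \sum_(j < n) M i j * N i j.
Proof.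
rewrite /fdot /mxtrace exchange_big /=; apply: eq_bigr => j _.
by rewrite mxE; apply: eq_bigr => i _; rewrite mxE.
Qed.

Lemma frobenius_ge0 m n (M : 'M[R]_(m, n)) : 0 <= frobenius M.
Proof. exact: sqrtr_ge0. Qed.

Lemma frobenius_sqr m n (M : 'M[R]_(m, n)) : frobenius M ^+ 2 = fdot M M.
Proof.
rewrite fdotE sqr_sqrtr; last by do 2!apply: sumr_ge0 => ? _; exact: sqr_ge0.
by apply: eq_bigr => i _; apply: eq_bigr => j _; rewrite expr2.
Qed.

Lemma fdotC m n (M N : 'M[R]_(m, n)) : fdot M N = fdot N M.
Proof. by rewrite /fdot -mxtrace_tr trmx_mul trmxK. Qed.

Lemma fdotDr m n (M N K : 'M[R]_(m, n)) : fdot M (N + K) = fdot M N + fdot M K.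
Proof. by rewrite /fdot mulmxDr mxtraceD. Qed.

Lemma fdotZr m n c (M N : 'M[R]_(m, n)) : fdot M (c *: N) = c * fdot M N.
Proof. by rewrite /fdot -scalemxAr mxtraceZ. Qed.

Lemma fdotDl m n (M N K : 'M[R]_(m, n)) : fdot (N + K) M = fdot N M + fdot K M.
Proof. by rewrite fdotC fdotDr !(fdotC M). Qed.

Lemma fdotZl m n c (M N : 'M[R]_(m, n)) : fdot (c *: N) M = c * fdot N M.
Proof. by rewrite fdotC fdotZr fdotC. Qed.

Lemma fdot_mull m n p (A : 'M[R]_(p, m)) (M : 'M[R]_(m, n)) N :
  fdot (A *m M) N = fdot M (A^T *m N).
Proof. by rewrite /fdot trmx_mul mulmxA. Qed.

Lemma fdot_mulr m n p (B : 'M[R]_(n, p)) (M : 'M[R]_(m, n)) N :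
  fdot (M *m B) N = fdot M (N *m B^T).
Proof. by rewrite /fdot trmx_mul -mulmxA mxtrace_mulC -mulmxA. Qed.

Lemma fdot_tr m n (M N : 'M[R]_(m, n)) : fdot M^T N^T = fdot M N.
Proof. by rewrite /fdot trmxK mxtrace_mulC -mxtrace_tr trmx_mul trmxK. Qed.

Lemma fdot_ge0 m n (M : 'M[R]_(m, n)) : 0 <= fdot M M.
Proof. by rewrite -frobenius_sqr sqr_ge0. Qed.

Lemma fdot_eq0 m n (M : 'M[R]_(m, n)) : (fdot M M == 0) = (M == 0).
Proof.
apply/eqP/eqP => [|->]; last by rewrite /fdot mulmx0 mxtrace0.
rewrite fdotE => /eqP; rewrite psumr_eq0; last first.
  by move=> i _; apply: sumr_ge0 => j _; rewrite -expr2 sqr_ge0.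
move/allP => M0; apply/matrixP => i j; rewrite mxE; apply/eqP.
have := M0 i (mem_index_enum _); rewrite psumr_eq0 => [/allP/(_ j)|k _].
  by rewrite mem_index_enum -expr2 sqrf_eq0; apply.
by rewrite -expr2 sqr_ge0.
Qed.

Lemma fdot_gt0 m n (M : 'M[R]_(m, n)) : (0 < fdot M M) = (M != 0).
Proof. by rewrite lt_def fdot_ge0 andbT fdot_eq0. Qed.

Lemma fdotDD m n (M N : 'M[R]_(m, n)) :
  fdot (M + N) (M + N) = fdot M M + 2 * fdot M N + fdot N N.
Proof. by rewrite fdotDl !fdotDr (fdotC N M); ring. Qed.

Lemma frobenius_le m n p q (M : 'M[R]_(m, n)) (N : 'M[R]_(p, q)) :
  (frobenius M <= frobenius N) = (fdot M M <= fdot N N).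
Proof. by rewrite -!frobenius_sqr ler_sqr ?nnegrE ?frobenius_ge0. Qed.

Lemma frobenius_eq1 m n (M : 'M[R]_(m, n)) : frobenius M = 1 <-> fdot M M = 1.
Proof.
rewrite -frobenius_sqr; split => [->|/eqP]; first exact: expr1n.
by rewrite sqrp_eq1 ?frobenius_ge0 // => /eqP.
Qed.

Lemma frobeniusZ m n c (M : 'M[R]_(m, n)) :
  0 <= c -> frobenius (c *: M) = c * frobenius M.
Proof.
move=> c0; apply/eqP; rewrite -(@eqrXn2 _ 2) ?mulr_ge0 ?frobenius_ge0 //.
by rewrite exprMn !frobenius_sqr fdotZl fdotZr mulrA expr2.
Qed.

(** The squared norm of [N.N M - M.N N] is [N.N] times the difference of the
two sides. *)
Lemma fdot_CauchySchwarz m n (M N : 'M[R]_(m, n)) :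
  fdot M N ^+ 2 <= fdot M M * fdot N N.
Proof.
have [->|N0] := eqVneq N 0.
  by rewrite {1}/fdot mulmx0 mxtrace0 expr0n mulr_ge0 ?fdot_ge0.
have N_gt0 : 0 < fdot N N by rewrite fdot_gt0.
have := fdot_ge0 (fdot N N *: M + (- fdot M N) *: N).
rewrite fdotDD !fdotZl !fdotZr => h.
rewrite -subr_ge0 -(pmulr_rge0 _ N_gt0).
by apply: le_trans h _; rewrite le_eqVlt; apply/orP; left; apply/eqP; ring.
Qed.

Lemma fdot_rows m n (M : 'M[R]_(m, n)) :
  fdot M M = \sum_i fdot (row i M) (row i M).
Proof.
rewrite fdotE; apply: eq_bigr => i _; rewrite fdotE big_ord1.
by apply: eq_bigr => j _; rewrite mxE.
Qed.

Lemma fdot_cols m n (M : 'M[R]_(m, n)) :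
  fdot M M = \sum_j fdot (col j M) (col j M).
Proof.
by rewrite -fdot_tr fdot_rows; apply: eq_bigr => i _; rewrite -tr_col fdot_tr.
Qed.

Lemma fdot_mul_le m n p (M : 'M[R]_(m, n)) (N : 'M[R]_(n, p)) :
  fdot (M *m N) (M *m N) <= fdot M M * fdot N N.
Proof.
rewrite fdotE (fdot_rows M) (fdot_cols N) mulr_suml ler_sum // => i _.
rewrite mulr_sumr ler_sum // => j _; rewrite -expr2.
rewrite -(fdot_tr (col j N)); suff -> : (M *m N) i j = fdot (row i M) (col j N)^T.
  exact: fdot_CauchySchwarz.
by rewrite mxE fdotE big_ord1; apply: eq_bigr => k _; rewrite !mxE.
Qed.

(** [M N] is orthogonal to itself when [M^T] annihilates it. *)
Lemma mulmx_tr_eq0 m n p (M : 'M[R]_(m, n)) (N : 'M[R]_(n, p)) :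
  M^T *m (M *m N) = 0 -> M *m N = 0.
Proof.
move=> MMN0; apply/eqP; rewrite -fdot_eq0 fdot_mull MMN0.
by rewrite /fdot mulmx0 mxtrace0.
Qed.

End Fdot.
(** * Spectral norm and smallest singular value *)

Section SpectralBounds.
Context {R : realType}.

Lemma le_spectral_norm m n (M : 'M[R]_(m, n)) (v : 'cV[R]_n) :
  fdot (M *m v) (M *m v) <= spectral_norm M ^+ 2 * fdot v v.
Proof.
set S := [set frobenius (M *m v) | v in [set v : 'cV[R]_n | frobenius v <= 1]].
have ubS : has_ubound S.
  exists (frobenius M) => _ [w /= w1 <-]; rewrite frobenius_le.
  apply: le_trans (fdot_mul_le _ _) _; apply: ler_piMr (fdot_ge0 _) _.
  by rewrite -frobenius_sqr expr_le1 ?frobenius_ge0.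
have [->|v0] := eqVneq v 0; first by rewrite mulmx0 /fdot !mulmx0 !mxtrace0 mulr0.
have v_gt0 : 0 < frobenius v.
  by rewrite lt_def frobenius_ge0 andbT -sqrf_eq0 frobenius_sqr fdot_eq0.
have c0 : 0 <= (frobenius v)^-1 by rewrite invr_ge0 ltW.
have : S (frobenius (M *m ((frobenius v)^-1 *: v))).
  by exists ((frobenius v)^-1 *: v); rewrite //= frobeniusZ // mulVf ?gt_eqF.
move/(ub_le_sup ubS); rewrite -scalemxAr frobeniusZ //.
rewrite mulrC ler_pdivrMr // -!frobenius_sqr -exprMn => h.
by rewrite ler_sqr ?nnegrE ?frobenius_ge0 // (le_trans (frobenius_ge0 _) h).
Qed.

Lemma singular_value_tr m n (M : 'M[R]_(m, n)) s :
  singular_value M s -> singular_value M^T s.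
Proof. by move=> [s0 [u [v [u1 v1 Mv Mu]]]]; split=> //; exists v, u; rewrite trmxK. Qed.

Lemma sigma_min_tr m n (M : 'M[R]_(m, n)) : sigma_min M^T = sigma_min M.
Proof.
rewrite /sigma_min; congr inf; apply/seteqP; split=> s /=.
  by move/singular_value_tr; rewrite trmxK.
exact: singular_value_tr.
Qed.

(** A matrix with an empty side has no singular value, and then the infimum is
the default value 0. *)
Lemma sigma_min_ge0 m n (M : 'M[R]_(m, n)) : 0 <= sigma_min M.
Proof.
rewrite /sigma_min; have [->|/set0P S0] := eqVneq [set s | singular_value M s] set0.
  by rewrite inf0.
by apply: lb_le_inf => // s [].
Qed.

Lemma sigma_min_le m n (M : 'M[R]_(m, n)) s :
  singular_value M s -> sigma_min M <= s.
Proof. by apply: ge_inf; exists 0 => t []. Qed.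

Lemma exists_unit_multiple n (v : 'cV[R]_n) : v != 0 ->
  exists2 c : R, c != 0 & fdot (c *: v) (c *: v) = 1.
Proof.
move=> v0; have v_gt0 : 0 < fdot v v by rewrite fdot_gt0.
exists (Num.sqrt (fdot v v))^-1; first by rewrite invr_eq0 sqrtr_eq0 -ltNge.
by rewrite fdotZl fdotZr mulrA -invfM -expr2 sqr_sqrtr ?ltW // mulVf ?gt_eqF.
Qed.

(** Let [s^2] be the infimum of the Rayleigh quotient of [M^T M]. The matrix
[N = M^T M - s^2 I] is positive semidefinite. If it were invertible, then
[|N y|^2 <= K y.(N y)] would give [y.(N y) >= |y|^2 / c] for some [c > 0], and the
infimum would be larger than [s^2]. So [N] is singular, and a vector of its
kernel attains the infimum. *)
Lemma least_right_singular_vector m n (M : 'M[R]_(m, n)) (x : 'cV[R]_n) :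
  x != 0 -> exists (s : R) (v : 'cV[R]_n),
    [/\ 0 <= s, fdot v v = 1, M^T *m (M *m v) = s ^+ 2 *: v &
        forall y : 'cV[R]_n, s ^+ 2 * fdot y y <= fdot (M *m y) (M *m y)].
Proof.
move=> x0.
set S := [set t | exists2 y : 'cV[R]_n, fdot y y = 1 & t = fdot (M *m y) (M *m y)].
have S0 : S !=set0.
  have [c _ cx] := exists_unit_multiple x0.
  by exists (fdot (M *m (c *: x)) (M *m (c *: x))), (c *: x).
have lbS : lbound S 0 by move=> _ [y _ ->]; exact: fdot_ge0.
have inf_ge0 : 0 <= inf S by exact: lb_le_inf.
pose N : 'M[R]_n := M^T *m M - (inf S)%:M.
have Ntr : N^T = N by rewrite /N linearB /= trmx_mul trmxK tr_scalar_mx.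
have qE (y : 'cV[R]_n) : fdot y (N *m y) = fdot (M *m y) (M *m y) - inf S * fdot y y.
  by rewrite /N mulmxBl mul_scalar_mx -scaleNr fdotDr fdotZr -mulmxA mulNr
    (fdot_mull M y).
have rayleigh (y : 'cV[R]_n) : inf S * fdot y y <= fdot (M *m y) (M *m y).
  have [->|y0] := eqVneq y 0; first by rewrite mulmx0 /fdot !mulmx0 !mxtrace0 mulr0.
  have [c c0 cy] := exists_unit_multiple y0.
  have : inf S <= fdot (M *m (c *: y)) (M *m (c *: y)).
    by apply: ge_inf; [exists 0 | exists (c *: y)].
  rewrite -scalemxAr fdotZl fdotZr; rewrite fdotZl fdotZr in cy => h.
  have cc_gt0 : 0 < c * c by rewrite -expr2 exprn_even_gt0.
  by rewrite -(ler_pM2l cc_gt0) mulrCA -!mulrA cy mulr1.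
have q_ge0 (y : 'cV[R]_n) : 0 <= fdot y (N *m y) by rewrite qE subr_ge0.
have detN : \det N == 0.
  apply/negPn/negP => detN.
  have Nu : N \in unitmx by rewrite unitmxE unitfE.
  pose K := fdot M M + 1.
  have K_gt0 : 0 < K by rewrite ltr_wpDl ?fdot_ge0.
  have qK (y : 'cV[R]_n) : fdot y (N *m y) <= K * fdot y y.
    rewrite qE mulrDl mul1r; have := fdot_mul_le M y; have := fdot_ge0 y.
    by have := mulr_ge0 inf_ge0 (fdot_ge0 y); lra.
  have NK (y : 'cV[R]_n) : fdot (N *m y) (N *m y) <= K * fdot y (N *m y).
    (* The descent step of length 1/K for the quadratic form y.(N y). *)
    have := q_ge0 (y + (- K^-1) *: (N *m y)).
    have Nsym : fdot (N *m y) (N *m y) = fdot y (N *m (N *m y)).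
      by rewrite fdot_mull Ntr.
    rewrite mulmxDr -scalemxAr fdotDl !fdotDr !fdotZl !fdotZr -Nsym => h.
    have := qK (N *m y); set a := fdot (N *m y) (N *m y) in h *.
    set b := fdot (N *m y) (N *m (N *m y)) in h * => ba.
    have h2 : K^-1 * (K^-1 * b) <= K^-1 * a.
      by rewrite ler_pM2l ?invr_gt0 // mulrC ler_pdivrMr // mulrC.
    rewrite -ler_pdivrMl //; lra.
  pose c := fdot (invmx N) (invmx N) * K + 1.
  have c_gt0 : 0 < c by rewrite ltr_wpDl // mulr_ge0 ?fdot_ge0 // ltW.
  (* 1/c is then a lower bound of y.(N y) on the unit sphere. *)
  have : inf S + c^-1 <= inf S.
    apply: lb_le_inf => // _ [y y1 ->]; rewrite -lerBrDl.
    have -> : fdot (M *m y) (M *m y) - inf S = fdot y (N *m y).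
      by rewrite qE y1 mulr1.
    rewrite -[c^-1]mul1r ler_pdivrMr // -[X in X <= _]y1 -{1 2}(mulKmx Nu y).
    apply: le_trans (fdot_mul_le _ _) _.
    apply: le_trans (ler_wpM2l (fdot_ge0 _) (NK y)) _.
    by rewrite mulrA mulrC ler_wpM2l // /c lerDl.
  by rewrite gerDl leNgt invr_gt0 c_gt0.
have /det0P [w w0 wN] := detN.
have wt0 : w^T != 0 by rewrite -(inj_eq trmx_inj) trmxK trmx0.
have [c c0 cw] := exists_unit_multiple wt0.
exists (Num.sqrt (inf S)), (c *: w^T); rewrite sqr_sqrtr //; split=> //.
have : N *m (c *: w^T) = 0 by rewrite -scalemxAr -Ntr -trmx_mul wN trmx0 scaler0.
by rewrite /N mulmxBl mul_scalar_mx -mulmxA => /eqP; rewrite subr_eq0 => /eqP.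
Qed.

Lemma singular_value_of_gram m n (M : 'M[R]_(m, n)) s (v : 'cV[R]_n) :
  0 < s -> fdot v v = 1 -> M^T *m (M *m v) = s ^+ 2 *: v -> singular_value M s.
Proof.
move=> s0 v1 Mv; split; first exact: ltW.
exists (s^-1 *: (M *m v)), v; split.
- apply/frobenius_eq1; rewrite fdotZl fdotZr fdot_mull Mv fdotZr v1 mulr1.
  by rewrite expr2 mulrA -[_ / s]mulrC; field; rewrite gt_eqF.
- exact/frobenius_eq1.
- by rewrite scalerA mulfV ?gt_eqF // scale1r.
- by rewrite -scalemxAr Mv scalerA expr2 mulrA mulVf ?mul1r ?gt_eqF.
Qed.

Lemma injective_least_singular_value m n (M : 'M[R]_(m, n)) (x : 'cV[R]_n) :
  (forall v : 'cV[R]_n, M *m v = 0 -> v = 0) ->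
  x != 0 -> exists s : R, [/\ 0 <= s, singular_value M s &
    forall y : 'cV[R]_n, s ^+ 2 * fdot y y <= fdot (M *m y) (M *m y)].
Proof.
move=> inj x0; have [s [v [s0 v1 Mv sM]]] := least_right_singular_vector M x0.
exists s; split=> //; apply: (singular_value_of_gram _ v1 Mv).
rewrite lt_def s0 andbT; apply/eqP => s_eq0.
have /inj v0 : M *m v = 0.
  by apply: mulmx_tr_eq0; rewrite Mv s_eq0 expr0n scale0r.
by move: v1 => /eqP; rewrite v0 /fdot mulmx0 mxtrace0 eq_sym oner_eq0.
Qed.

(** If [M] is injective its least right singular vector gives the bound on the
whole space. If [M^T] is injective, with least singular value [s], then
[|x|^2 = w.(M x) <= |w| |M x|] and [s |w| <= |x|] give [s |x| <= |M x|] for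
[x = M^T w]. If neither is, unit vectors of the two kernels show that 0 is a
singular value, and the bound is trivial. *)
Lemma sigma_min_bound m n (M : 'M[R]_(m, n)) (w : 'cV[R]_m) :
  sigma_min M ^+ 2 * fdot (M^T *m w) (M^T *m w)
  <= fdot (M *m (M^T *m w)) (M *m (M^T *m w)).
Proof.
set x := M^T *m w.
have [x0|x0] := eqVneq x 0; first by rewrite x0 mulmx0 /fdot !mulmx0 !mxtrace0 mulr0.
have le_sigma s : singular_value M s -> sigma_min M ^+ 2 <= s ^+ 2.
  move=> Ms; rewrite ler_sqr ?nnegrE ?sigma_min_ge0 ?sigma_min_le //.
  by case: Ms.
have [inj|/existsNP [v /not_implyP [Mv0 /eqP v0]]] :=
    pselect (forall v : 'cV[R]_n, M *m v = 0 -> v = 0).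
  have [s [s0 Ms sM]] := injective_least_singular_value inj x0.
  by apply: le_trans (sM x); rewrite ler_wpM2r ?fdot_ge0 ?le_sigma.
have [injT|/existsNP [u /not_implyP [Mu0 /eqP u0]]] :=
    pselect (forall v : 'cV[R]_m, M^T *m v = 0 -> v = 0).
  have w0 : w != 0 by apply: contra_neq x0 => w0; rewrite /x w0 mulmx0.
  have [s [s0 /singular_value_tr Ms sM]] := injective_least_singular_value injT w0.
  rewrite trmxK in Ms.
  have x_gt0 : 0 < fdot x x by rewrite fdot_gt0.
  have w_gt0 : 0 < fdot w w by rewrite fdot_gt0.
  apply: le_trans (_ : s ^+ 2 * fdot x x <= _).
    by rewrite ler_wpM2r ?fdot_ge0 ?le_sigma.
  have cs := fdot_CauchySchwarz w (M *m x).
  have xE : fdot w (M *m x) = fdot x x by rewrite fdotC fdot_mull fdotC.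
  have := sM w; rewrite -/x => sw.
  rewrite xE in cs.
  rewrite -(ler_pM2l w_gt0); apply: le_trans cs.
  by rewrite mulrCA mulrA [leRHS]expr2 ler_pM2r.
suff : singular_value M 0.
  by move/le_sigma; rewrite expr0n => h; apply: le_trans (fdot_ge0 _);
     rewrite mulr_le0_ge0 ?fdot_ge0.
split=> //; have [c c0 cv] := exists_unit_multiple v0.
have [e e0 eu] := exists_unit_multiple u0.
exists (e *: u), (c *: v); split; try exact/frobenius_eq1.
  by rewrite -scalemxAr Mv0 scaler0 scale0r.
by rewrite -scalemxAr Mu0 scaler0 scale0r.
Qed.

End SpectralBounds.
(** * Moore-Penrose inverse and the minimum norm solution *)

Section MoorePenrose.
Context {R : realType}.

Lemma gram_unitmx m n (N : 'M[R]_(m, n)) : row_free N -> N *m N^T \in unitmx.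
Proof.
move=> Nfree; rewrite -row_free_unit; apply: inj_row_free => v vN.
have : N^T *m v^T = 0.
  apply: mulmx_tr_eq0; rewrite trmxK mulmxA.
  by have := congr1 trmx vN; rewrite !trmx_mul trmxK trmx0.
move/(congr1 trmx); rewrite trmx_mul !trmxK trmx0 => /eqP.
by rewrite (mulmx_free_eq0 _ Nfree) => /eqP.
Qed.

(** The inverse is [G^T (G G^T)^-1 (F^T F)^-1 F^T]; a rank factorization, which
every matrix has, reduces the general case to this one. *)
Lemma penrose_full_rank_factors m r n (F : 'M[R]_(m, r)) (G : 'M[R]_(r, n)) :
  row_full F -> row_free G -> exists Z, penrose (F *m G) Z.
Proof.
move=> Ffull Gfree; have GGu := gram_unitmx Gfree.
have FFu : F^T *m F \in unitmx.
  by rewrite -{2}[F]trmxK; apply/gram_unitmx; rewrite /row_free mxrank_tr.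
pose U := invmx (G *m G^T); pose V := invmx (F^T *m F).
have Ut : U^T = U by rewrite /U trmx_inv trmx_mul trmxK.
have Vt : V^T = V by rewrite /V trmx_inv trmx_mul trmxK.
pose Z := G^T *m U *m V *m F^T.
have MZ : F *m G *m Z = F *m V *m F^T.
  by rewrite /Z -!mulmxA; congr (_ *m _); rewrite !mulmxA mulmxV // mul1mx.
have ZM : Z *m (F *m G) = G^T *m U *m G.
  by rewrite /Z -!mulmxA; do 2 congr (_ *m _); rewrite !mulmxA -(mulmxA V) mulVmx ?mul1mx.
exists Z; split.
- by rewrite MZ -!mulmxA (mulmxA F^T) (mulKmx FFu).
- by rewrite ZM /Z -!mulmxA (mulmxA G) (mulKVmx GGu).
- by rewrite MZ !trmx_mul trmxK Vt mulmxA.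
- by rewrite ZM !trmx_mul trmxK Ut mulmxA.
Qed.

Lemma penrose_exists m n (M : 'M[R]_(m, n)) : exists G, penrose M G.
Proof.
rewrite -[M]mulmx_base.
exact: penrose_full_rank_factors (col_base_full M) (row_base_free M).
Qed.

Lemma mp_pinvP m n (M : 'M[R]_(m, n)) : penrose M (mp_pinv M).
Proof. exact: (@xgetPex _ 0 [set G | penrose M G] (penrose_exists M)). Qed.

Lemma mp_pinv_mul_tr m n (M : 'M[R]_(m, n)) : mp_pinv M *m M *m M^T = M^T.
Proof.
by have [MGM _ _ GMt] := mp_pinvP M; rewrite -{1}GMt -trmx_mul mulmxA MGM.
Qed.

Lemma tr_mul_mp_pinv m n (M : 'M[R]_(m, n)) : M^T *m (M *m mp_pinv M) = M^T.
Proof.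
by have [MGM _ MGt _] := mp_pinvP M; rewrite -{1}MGt -trmx_mul MGM.
Qed.

(** The matrices fixed by the orthogonal projection [D |-> A^+ A D B B^+], that
is, those whose columns lie in the row space of [A] and whose rows lie in the
column space of [B]. The grouping displays [D] as a function of [A D B]. *)
Definition in_row_col_space {m p q n} (A : 'M[R]_(m, p)) (B : 'M[R]_(q, n))
    (D : 'M[R]_(p, q)) : Prop :=
  mp_pinv A *m (A *m D *m B) *m mp_pinv B = D.

Section RowColSpace.
Context {m p q n : nat} (A : 'M[R]_(m, p)) (B : 'M[R]_(q, n)).

Lemma in_row_col_spaceD D E : in_row_col_space A B D ->
  in_row_col_space A B E -> in_row_col_space A B (D + E).
Proof.
rewrite /in_row_col_space => DE EE.
by rewrite mulmxDr mulmxDl mulmxDr mulmxDl DE EE.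
Qed.

Lemma in_row_col_spaceZ c D : in_row_col_space A B D ->
  in_row_col_space A B (c *: D).
Proof.
rewrite /in_row_col_space => DE.
by rewrite -scalemxAr -scalemxAl -scalemxAr -scalemxAl DE.
Qed.

Lemma in_row_col_space_mul (W : 'M[R]_(m, n)) :
  in_row_col_space A B (A^T *m W *m B^T).
Proof.
rewrite /in_row_col_space !mulmxA mp_pinv_mul_tr -!mulmxA.
by rewrite tr_mul_mp_pinv.
Qed.

(** [A^+ A = A^T (A^+)^T] and [B B^+ = (B^+)^T B^T], as both are symmetric. *)
Lemma in_row_col_space_factor D : in_row_col_space A B D ->
  exists W, D = A^T *m W *m B^T.
Proof.
move=> DE; have [_ _ _ GAt] := mp_pinvP A; have [_ _ BGt _] := mp_pinvP B.
exists ((mp_pinv A)^T *m D *m (mp_pinv B)^T).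
rewrite -!mulmxA -trmx_mul BGt !mulmxA -trmx_mul GAt.
by rewrite -{1}DE !mulmxA.
Qed.

Lemma in_row_col_space_le D : in_row_col_space A B D ->
  fdot D D <= fdot (mp_pinv A) (mp_pinv A) * fdot (mp_pinv B) (mp_pinv B)
              * fdot (A *m D *m B) (A *m D *m B).
Proof.
move=> {1 2}<-; apply: le_trans (fdot_mul_le _ _) _.
by rewrite mulrAC ler_wpM2r ?fdot_ge0 ?fdot_mul_le.
Qed.

Lemma sigma_min_mul_bound k l r (M : 'M[R]_(k, l)) (W : 'M[R]_(k, r)) :
  sigma_min M ^+ 2 * fdot (M^T *m W) (M^T *m W)
  <= fdot (M *m (M^T *m W)) (M *m (M^T *m W)).
Proof.
rewrite fdot_cols [leRHS]fdot_cols mulr_sumr ler_sum // => j _.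
by rewrite !colE -!mulmxA sigma_min_bound.
Qed.

(** Apply the vector bound to the columns of [D B] and of [D^T]. *)
Lemma sigma_min_residual_bound D : in_row_col_space A B D ->
  sigma_min A ^+ 2 * sigma_min B ^+ 2 * fdot D D
  <= fdot (A *m D *m B) (A *m D *m B).
Proof.
case/in_row_col_space_factor => K DK.
pose W := K *m B^T; pose V := A^T *m K.
have DW : D = A^T *m W by rewrite DK -mulmxA.
have DV : D = V *m B^T := DK.
have hB : sigma_min B ^+ 2 * fdot D D <= fdot (D *m B) (D *m B).
  rewrite -(fdot_tr D) -(fdot_tr (D *m B)) trmx_mul.
  have DtE : D^T = B^T^T *m V^T by rewrite -trmx_mul -DV.
  by rewrite DtE -sigma_min_tr sigma_min_mul_bound.
have := sigma_min_mul_bound A (W *m B); rewrite (mulmxA A^T) -DW (mulmxA A).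
apply: le_trans.
by rewrite -mulrA ler_wpM2l ?sqr_ge0.
Qed.

Lemma range_sub_in_row_col_space (X : 'M[R]_(p, q)) :
  range_sub X A^T -> range_sub X^T B -> in_row_col_space A B X.
Proof.
rewrite /range_sub !trmxK => /submxP [W XW] /submxP [V XV].
have XE : X = A^T *m W^T by rewrite -trmx_mul -XW trmxK.
rewrite /in_row_col_space !mulmxA XE mulmxA mp_pinv_mul_tr -XE XV.
by rewrite -!mulmxA tr_mul_mp_pinv.
Qed.

Context {C : 'M[R]_(m, n)}.
Let Xs := mp_pinv A *m C *m mp_pinv B.

Lemma mp_pinv_solution Y : is_solution A B C Y -> is_solution A B C Xs.
Proof.
have [AGA _ _ _] := mp_pinvP A; have [BGB _ _ _] := mp_pinvP B.
rewrite /is_solution /Xs => <-.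
by rewrite !mulmxA AGA -!mulmxA (mulmxA B) BGB.
Qed.

Lemma mp_pinv_in_row_col_space Y : is_solution A B C Y ->
  in_row_col_space A B Xs.
Proof. by move/mp_pinv_solution => XsC; rewrite /in_row_col_space XsC. Qed.

(** The difference of two solutions is annihilated by [A _ B], hence orthogonal
to [Xs = A^T K B^T], and Pythagoras applies. *)
Lemma mp_pinv_unique_min_norm Y : is_solution A B C Y ->
  unique_min_norm_solution A B C Xs.
Proof.
move=> YC; have XsC := mp_pinv_solution YC; split=> // Z ZC /eqP ZXs.
have XsE := mp_pinv_in_row_col_space YC.
have [K XsK] := in_row_col_space_factor XsE.
have AZB : A *m (Z - Xs) *m B = 0.
  by rewrite mulmxBr mulmxBl ZC XsC subrr.
have orth : fdot Xs (Z - Xs) = 0.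
  by rewrite {1}XsK fdot_mulr trmxK fdot_mull trmxK mulmxA AZB /fdot mulmx0 mxtrace0.
rewrite ltNge frobenius_le -ltNge -[in ltRHS](subrKC Xs Z) fdotDD orth mulr0 addr0.
by rewrite ltrDl fdot_gt0 subr_eq0.
Qed.

End RowColSpace.
End MoorePenrose.
(** * One greedy step *)

Section OneStep.
Context {R : realType} {m p q n : nat}.
Variables (A : 'M[R]_(m, p)) (B : 'M[R]_(q, n)) (theta alpha : R).
Hypothesis rowA : forall i, row i A != 0.

Let step : R := 2 * alpha - alpha ^+ 2 * spectral_norm B ^+ 2.

(** The hypothesis also excludes [B = 0], since then [2 / |B|^2 = 0]. *)
Lemma step_gt0 : 0 < alpha < 2 / spectral_norm B ^+ 2 -> 0 < step.
Proof.
case/andP => alpha0 h; have B_gt0 : 0 < spectral_norm B ^+ 2.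
  rewrite lt_def sqr_ge0 andbT; apply: contraTneq h => ->.
  by rewrite invr0 mulr0 -leNgt ltW.
rewrite ltr_pdivlMr // in h.
have -> : step = alpha * (2 - alpha * spectral_norm B ^+ 2) by rewrite /step; ring.
by rewrite mulr_gt0 ?subr_gt0.
Qed.

Definition kaczmarz_update (X : 'M[R]_(p, q)) (Rk : 'M[R]_(m, n)) (i : 'I_m) :
    'M[R]_(p, q) :=
  X + (alpha / frobenius (row i A) ^+ 2) *: ((row i A)^T *m (row i Rk *m B^T)).

Lemma kaczmarz_step_error (X Y : 'M[R]_(p, q)) (Rk : 'M[R]_(m, n)) (i : 'I_m) :
  Rk = A *m (Y - X) *m B ->
  fdot (kaczmarz_update X Rk i - Y) (kaczmarz_update X Rk i - Y)
  <= fdot (X - Y) (X - Y) - step * row_ratio A Rk i.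
Proof.
move=> RkE; rewrite /row_ratio; set X' := kaczmarz_update X Rk i.
have -> : X' - Y = (X - Y) + (alpha / frobenius (row i A) ^+ 2) *:
                ((row i A)^T *m (row i Rk *m B^T)) by rewrite addrAC.
rewrite !frobenius_sqr fdotDD !fdotZl !fdotZr.
set a := row i A; set r := row i Rk.
have a_gt0 : 0 < fdot a a by rewrite fdot_gt0 rowA.
have -> : fdot (X - Y) (a^T *m (r *m B^T)) = - fdot r r.
  rewrite -fdot_mull -fdot_mulr /a -!row_mul.
  have -> : A *m (X - Y) *m B = - Rk by rewrite RkE -mulNmx -mulmxN opprB.
  by rewrite -scaleN1r linearZ /= fdotZl mulN1r.
have gram : fdot (a^T *m (r *m B^T)) (a^T *m (r *m B^T))
    <= fdot a a * (spectral_norm B ^+ 2 * fdot r r).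
  apply: le_trans (fdot_mul_le _ _) _; rewrite fdot_tr ler_wpM2l ?fdot_ge0 //.
  by rewrite -(fdot_tr r) -(fdot_tr (_ *m _)) trmx_mul trmxK le_spectral_norm.
have c2 : (alpha / fdot a a) * ((alpha / fdot a a) *
    fdot (a^T *m (r *m B^T)) (a^T *m (r *m B^T)))
    <= alpha ^+ 2 * spectral_norm B ^+ 2 * (fdot r r / fdot a a).
  rewrite mulrA -expr2.
  apply: le_trans (ler_wpM2l (sqr_ge0 _) gram) _.
  by rewrite le_eqVlt; apply/orP; left; apply/eqP; field; rewrite gt_eqF.
have -> : step * (fdot r r / fdot a a) =
    2 * (alpha / fdot a a * fdot r r)
    - alpha ^+ 2 * spectral_norm B ^+ 2 * (fdot r r / fdot a a).
  by rewrite /step; field; rewrite gt_eqF.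
lra.
Qed.

Section Ratios.
Variable Rk : 'M[R]_(m, n).
Hypothesis notconst :
  ~ (forall i j : 'I_m, row_ratio A Rk i = row_ratio A Rk j).

Lemma row_ratio_ge0 i : 0 <= row_ratio A Rk i.
Proof. by rewrite /row_ratio divr_ge0 ?sqr_ge0. Qed.

Lemma row_ratioK i : row_ratio A Rk i * fdot (row i A) (row i A)
  = fdot (row i Rk) (row i Rk).
Proof.
by rewrite /row_ratio !frobenius_sqr mulfVK // gt_eqF // fdot_gt0 rowA.
Qed.

Lemma row_ratio_le_max i : row_ratio A Rk i <= max_ratio A Rk.
Proof. exact: le_bigmax. Qed.

Lemma exists_row_ratio_gt0 : exists i, 0 < row_ratio A Rk i.
Proof.
apply: contrapT => no; apply: notconst.
have r0 i : row_ratio A Rk i = 0.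
  by apply/eqP; rewrite eq_le row_ratio_ge0 andbT leNgt; apply/negP => ri;
     apply: no; exists i.
by move=> i j; rewrite !r0.
Qed.

Lemma max_ratio_gt0 : 0 < max_ratio A Rk.
Proof.
have [i ri] := exists_row_ratio_gt0.
exact: lt_le_trans ri (row_ratio_le_max i).
Qed.

Lemma residual_gt0 : 0 < fdot Rk Rk.
Proof.
have [i ri] := exists_row_ratio_gt0; rewrite fdot_gt0; apply: contraTneq ri => ->.
by rewrite /row_ratio frobenius_sqr row0 /fdot mulmx0 mxtrace0 mul0r ltxx.
Qed.

Lemma row_count_gt0 : 0 < m%:R :> R.
Proof.
have [i _] := exists_row_ratio_gt0.
by rewrite ltr0n (leq_ltn_trans _ (ltn_ord i)).
Qed.

Lemma mean_ratioE : \sum_(i < m) row_ratio A Rk i = m%:R * mean_ratio A Rk.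
Proof. by rewrite /mean_ratio mulVKf // gt_eqF ?row_count_gt0. Qed.

Lemma mean_ratio_le_max : mean_ratio A Rk <= max_ratio A Rk.
Proof.
rewrite -(ler_pM2l row_count_gt0) -mean_ratioE.
apply: le_trans (_ : \sum_(i < m) max_ratio A Rk <= _).
  by apply: ler_sum => i _; exact: row_ratio_le_max.
by rewrite sumr_const card_ord mulr_natl.
Qed.

Lemma exists_not_below_mean : exists i, ~~ below_mean A Rk i.
Proof.
apply: contrapT => no; have [i0 _] := exists_row_ratio_gt0.
have below i : row_ratio A Rk i < mean_ratio A Rk.
  by apply/negPn/negP => bi; apply: no; exists i.
have : \sum_(i < m) row_ratio A Rk i < \sum_(i < m) mean_ratio A Rk.
  by apply: ltr_sum => //; apply/hasP; exists i0; rewrite ?mem_index_enum.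
by rewrite sumr_const card_ord mean_ratioE mulr_natl ltxx.
Qed.

Lemma epsilonK : epsilon A Rk * max_ratio A Rk = mean_ratio A Rk.
Proof. by rewrite /epsilon mulfVK // gt_eqF ?max_ratio_gt0. Qed.

Lemma epsilon_ge0 : 0 <= epsilon A Rk.
Proof.
rewrite /epsilon divr_ge0 //; last exact: ltW max_ratio_gt0.
by rewrite /mean_ratio mulr_ge0 ?invr_ge0 ?ler0n ?sumr_ge0 // => i _; exact: row_ratio_ge0.
Qed.

Lemma epsilon_le1 : epsilon A Rk <= 1.
Proof. by rewrite /epsilon ler_pdivrMr ?max_ratio_gt0 // mul1r mean_ratio_le_max. Qed.

Let denom := \sum_(i < m | ~~ below_mean A Rk i) frobenius (row i A) ^+ 2
             + epsilon A Rk
             * \sum_(i < m | below_mean A Rk i) frobenius (row i A) ^+ 2.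

Lemma denorow_count_gt0 : 0 < denom.
Proof.
have [i bi] := exists_not_below_mean.
apply: ltr_pwDl; last by rewrite mulr_ge0 ?epsilon_ge0 ?sumr_ge0 // => j _; exact: sqr_ge0.
rewrite (bigD1 i) //=; apply: ltr_pwDl.
  by rewrite frobenius_sqr fdot_gt0 rowA.
by rewrite sumr_ge0 // => j _; exact: sqr_ge0.
Qed.

Lemma frobenius_rowsE : frobenius A ^+ 2 =
  \sum_(i < m | ~~ below_mean A Rk i) frobenius (row i A) ^+ 2
  + \sum_(i < m | below_mean A Rk i) frobenius (row i A) ^+ 2.
Proof.
rewrite frobenius_sqr fdot_rows (bigID (below_mean A Rk)) /= addrC.
by congr (_ + _); apply: eq_bigr => i _; rewrite frobenius_sqr.
Qed.

Lemma denom_le : denom <= frobenius A ^+ 2.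
Proof.
rewrite frobenius_rowsE lerD2l ler_piMl ?epsilon_le1 // sumr_ge0 // => i _.
exact: sqr_ge0.
Qed.

(** In [|R|^2 = \sum_i ratio_i |a_i|^2], a ratio is at most the maximum, and at
most [epsilon] times the maximum on the rows below the mean. *)
Lemma residual_le_max_denom : fdot Rk Rk <= max_ratio A Rk * denom.
Proof.
rewrite fdot_rows (bigID (below_mean A Rk)) /= addrC mulrDr mulrA.
rewrite (mulrC _ (epsilon A Rk)) epsilonK !mulr_sumr.
apply: lerD; apply: ler_sum => i bi; rewrite -row_ratioK frobenius_sqr.
  by rewrite ler_wpM2r ?fdot_ge0 ?row_ratio_le_max.
by rewrite ler_wpM2r ?fdot_ge0 // ltW.
Qed.

Hypothesis theta01 : 0 <= theta <= 1.

Lemma phi_ge_inv : (frobenius A ^+ 2)^-1 <= phi theta A Rk.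
Proof.
have /andP [t0 t1] := theta01; rewrite /phi -/denom.
rewrite [leLHS](_ : _ = theta * (frobenius A ^+ 2)^-1
  + (1 - theta) * (frobenius A ^+ 2)^-1); last by rewrite -mulrDl subrKC mul1r.
rewrite lerD2r ler_wpM2l // lef_pV2 ?posrE ?denorow_count_gt0 ?denom_le //.
exact: lt_le_trans denorow_count_gt0 denom_le.
Qed.

Lemma phi_residual_le_xi : phi theta A Rk * fdot Rk Rk <= xi theta A Rk.
Proof.
have /andP [t0 t1] := theta01; rewrite /phi -/denom /xi mulrDl !frobenius_sqr.
rewrite -!mulrA; apply: lerD; last by rewrite (mulrC (_^-1)).
by rewrite ler_wpM2l // mulrC ler_pdivrMr ?denorow_count_gt0 ?residual_le_max_denom.
Qed.

Lemma greedy_row_ratio i : greedy_rows theta A Rk i ->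
  phi theta A Rk * fdot Rk Rk <= row_ratio A Rk i.
Proof.
rewrite /greedy_rows !frobenius_sqr -row_ratioK ler_pM2r ?fdot_gt0 ?rowA //.
exact/le_trans/phi_residual_le_xi.
Qed.

End Ratios.

Hypothesis alphaP : 0 < alpha < 2 / spectral_norm B ^+ 2.
Hypothesis theta01 : 0 <= theta <= 1.

(** With [K = |A^+|^2 |B^+|^2] one has [|D|^2 <= K |A D B|^2], so that
[1 - (step / |A|^2) / K] would already be a contraction factor; enlarging [K]
makes it nonnegative and the denominator visibly nonzero. *)
Definition uniform_rate : R :=
  1 - (step / frobenius A ^+ 2)
      / (fdot (mp_pinv A) (mp_pinv A) * fdot (mp_pinv B) (mp_pinv B)
         + step / frobenius A ^+ 2 + 1).

Let K_ge0 : 0 <= fdot (mp_pinv A) (mp_pinv A) * fdot (mp_pinv B) (mp_pinv B).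
Proof. by rewrite mulr_ge0 ?fdot_ge0. Qed.

Lemma uniform_rate_ge0 : 0 <= uniform_rate.
Proof.
have s_ge0 : 0 <= step / frobenius A ^+ 2.
  by rewrite divr_ge0 ?sqr_ge0 // ltW // step_gt0.
by rewrite /uniform_rate subr_ge0 ler_pdivrMr; have := K_ge0; lra.
Qed.

Lemma uniform_rate_lt1 : A != 0 -> uniform_rate < 1.
Proof.
move=> A0; have s_gt0 : 0 < step / frobenius A ^+ 2.
  by rewrite divr_gt0 ?step_gt0 // frobenius_sqr fdot_gt0.
by rewrite /uniform_rate ltrBlDr ltrDl divr_gt0 //; have := K_ge0; lra.
Qed.

Section Contraction.
Variables (X Y : 'M[R]_(p, q)) (Rk : 'M[R]_(m, n)) (i : 'I_m).
Let X' := kaczmarz_update X Rk i.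
Hypothesis RkE : Rk = A *m (Y - X) *m B.
Hypothesis notconst :
  ~ (forall i j : 'I_m, row_ratio A Rk i = row_ratio A Rk j).
Hypothesis supp : in_row_col_space A B (X - Y).

Let error_resid : A *m (X - Y) *m B = - Rk.
Proof. by rewrite RkE -mulNmx -mulmxN opprB. Qed.

Let residN : fdot (- Rk) (- Rk) = fdot Rk Rk.
Proof. by rewrite -scaleN1r fdotZl fdotZr !mulN1r opprK. Qed.

(** A zero error would make the residual zero and all the ratios equal. *)
Lemma error_gt0 : 0 < fdot (X - Y) (X - Y).
Proof.
rewrite fdot_gt0; apply: contraTneq (residual_gt0 notconst) => D0.
by rewrite -residN -error_resid D0 mulmx0 mul0mx /fdot mulmx0 mxtrace0 ltxx.
Qed.

Lemma delta_step_error_le :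
  delta_step theta alpha A B Rk * fdot (X - Y) (X - Y)
  <= delta alpha A B * fdot (X - Y) (X - Y).
Proof.
rewrite ler_wpM2r ?fdot_ge0 // /delta_step /delta lerD2l lerN2.
rewrite !ler_wpM2r ?sqr_ge0 // ler_wpM2l ?phi_ge_inv //.
exact: ltW (step_gt0 alphaP).
Qed.

Hypothesis greedy : greedy_rows theta A Rk i.

Lemma greedy_step_error : fdot (X' - Y) (X' - Y)
  <= fdot (X - Y) (X - Y) - step * (phi theta A Rk * fdot Rk Rk).
Proof.
apply: le_trans (kaczmarz_step_error _ RkE) _; rewrite lerD2l lerN2.
by rewrite ler_wpM2l ?greedy_row_ratio // ltW // step_gt0.
Qed.

Lemma greedy_step_delta : fdot (X' - Y) (X' - Y)
  <= delta_step theta alpha A B Rk * fdot (X - Y) (X - Y).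
Proof.
apply: le_trans greedy_step_error _.
rewrite /delta_step -/step [leRHS]mulrBl mul1r lerD2l lerN2.
rewrite -!mulrA ler_wpM2l //; first exact: ltW (step_gt0 alphaP).
rewrite ler_wpM2l //.
  by apply: le_trans (phi_ge_inv notconst theta01); rewrite invr_ge0 sqr_ge0.
by have := sigma_min_residual_bound supp; rewrite error_resid residN -!mulrA.
Qed.

Lemma greedy_step_uniform :
  fdot (X' - Y) (X' - Y) <= uniform_rate * fdot (X - Y) (X - Y).
Proof.
apply: le_trans greedy_step_error _.
rewrite /uniform_rate [leRHS]mulrBl mul1r lerD2l lerN2.
set s := step / _; set K := fdot _ _ * _.
have s_ge0 : 0 <= s by rewrite divr_ge0 ?sqr_ge0 // ltW // step_gt0.
apply: le_trans (_ : s * fdot Rk Rk <= _).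
  rewrite -mulrA ler_wpM2l // ler_pdivrMl; last by have := K_ge0; rewrite -/K; lra.
  apply: le_trans (in_row_col_space_le supp) _; rewrite -/K error_resid residN.
  by rewrite ler_wpM2r ?fdot_ge0 //; lra.
rewrite /s -mulrA ler_wpM2l; last by rewrite ler_wpM2r ?fdot_ge0 ?phi_ge_inv.
  by [].
by rewrite ltW // step_gt0.
Qed.

End Contraction.

End OneStep.
(** * Random variables determined by finitely many selections *)

Section FiniteHistory.
Context {d : measure_display} {T : measurableType d} {R : realType}.
Variables (P : probability T R) (m : nat) (I : nat -> T -> 'I_m).
Hypothesis measI : forall k i, measurable (I k @^-1` [set i]).

Definition past_determined {U : Type} (k : nat) (f : T -> U) : Prop :=
  forall w w', past I k w w' -> f w' = f w.

Lemma pastS k w : past I k.+1 w = past I k w `&` I k @^-1` [set I k w].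
Proof.
apply/seteqP; split=> [w' h|w' [h hk] j]; first by split=> [j jk|]; apply: h; rewrite // ltnW.
by rewrite ltnS leq_eqVlt => /orP [/eqP ->|/h].
Qed.

Lemma past_le j k w w' : (j <= k)%N -> past I k w w' -> past I j w w'.
Proof. by move=> jk h i ij; apply: h; exact: leq_trans jk. Qed.

Lemma past_eq k w w' : past I k w w' -> past I k w' = past I k w.
Proof.
by move=> h; apply/seteqP; split=> v hv j jk; rewrite hv // h.
Qed.

Lemma past_determined_le (U : Type) j k (f : T -> U) :
  (j <= k)%N -> past_determined j f -> past_determined k f.
Proof. by move=> jk fj w w' /(past_le jk); exact: fj. Qed.

Lemma measurable_past k w : measurable (past I k w).
Proof.
elim: k => [|k IHk]; last by rewrite pastS; exact: measurableI.
by rewrite (_ : past _ _ _ = setT) //; apply/seteqP; split.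
Qed.

(** An event determined by the first [k] selections is a countable (indeed
finite) union of atoms [past I k w]; histories are numbered by [pickle], so that
the countable union lemmas apply. *)
Lemma past_determined_set_ind k (Q : set T -> Prop) (S : set T) :
  Q set0 -> (forall F : nat -> set T, (forall i, Q (F i)) -> Q (\bigcup_i F i)) ->
  past_determined k S -> (forall w, S w -> Q (past I k w)) -> Q S.
Proof.
move=> Q0 QU Sk QS.
pose code w := pickle [ffun j : 'I_k => I j w].
have codeP w w' : code w' = code w -> past I k w w'.
  move=> /(pcan_inj pickleK) /ffunP h j jk.
  by have := h (Ordinal jk); rewrite !ffunE.
have -> : S = \bigcup_i (S `&` code @^-1` [set i]).
  by apply/seteqP; split=> [w Sw|w [i _ []] //]; exists (code w).
apply: QU => i; have [|/set0P [w [Sw /= wi]]] := eqVneq (S `&` code @^-1` [set i]) set0.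
  by move=> ->.
suff -> : S `&` code @^-1` [set i] = past I k w by exact: QS.
apply/seteqP; split=> w' /=; first by move=> [_ w'i]; apply: codeP; rewrite w'i wi.
move=> ww'; split; first by rewrite (Sk w w').
rewrite -wi /code; congr pickle; apply/ffunP => j.
by rewrite !ffunE; apply: ww'.
Qed.

Lemma past_determined_measurable k (S : set T) :
  past_determined k S -> measurable S.
Proof.
move=> Sk; apply: (past_determined_set_ind measurable0 _ Sk).
  by move=> F; exact: bigcupT_measurable.
by move=> w _; exact: measurable_past.
Qed.

Lemma past_determined_negligible k (S : set T) : past_determined k S ->
  (forall w, S w -> P (past I k w) = 0) -> P.-negligible S.
Proof.
move=> Sk S0; apply: (past_determined_set_ind _ _ Sk).
- exact: negligible_set0.
- by move=> F; exact: negligible_bigcup.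
- by move=> w /S0 Pw; apply/negligibleP => //; exact: measurable_past.
Qed.

Lemma past_determined_measurable_fun k (f : T -> R) :
  past_determined k f -> measurable_fun setT f.
Proof.
move=> fk _ Y _; rewrite setTI; apply: (@past_determined_measurable k).
by move=> w w' ww'; rewrite /preimage /= (fk _ _ ww').
Qed.

Lemma past_determined_bounded k (f : T -> R) : past_determined k f ->
  exists M, forall w, `|f w| <= M.
Proof.
move=> fk; pose hist w := [ffun j : 'I_k => I j w].
pose g h := xget 0 [set r | exists2 w, hist w = h & `|f w| = r].
have gE w : g (hist w) = `|f w|.
  have [w' hw' <-] : [set r | exists2 w', hist w' = hist w & `|f w'| = r] (g (hist w)).
    by apply: xgetPex; exists `|f w|, w.
  rewrite (fk w w') // => j jk; have /ffunP/(_ (Ordinal jk)) := hw'.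
  by rewrite !ffunE.
exists (\sum_h `|g h|) => w; rewrite -gE (bigD1 (hist w)) //=.
by rewrite (le_trans (ler_norm _)) // lerDl sumr_ge0.
Qed.

Lemma past_determined_integrable k (f : T -> R) : past_determined k f ->
  P.-integrable setT (EFin \o f).
Proof.
move=> fk; apply: measurable_bounded_integrable => //.
- by rewrite (le_lt_trans (probability_le1 _ _)) ?ltry.
- exact: past_determined_measurable_fun fk.
- have [M fM] := past_determined_bounded fk; exists M; split; first exact: num_real.
  by move=> x Mx y _ /=; exact: le_trans (fM y) (ltW Mx).
Qed.

(** Stated without a sign condition because the products of the [delta_step] are
nonnegative only almost surely. The maximum of the two sides is again determined by the past,
equals [g] almost surely and dominates [f] everywhere. *)
Lemma expectation_le_ae k (f g : T -> R) : past_determined k f ->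
  past_determined k g -> {ae P, forall w, f w <= g w} ->
  ('E_P[f] <= 'E_P[g])%E.
Proof.
move=> fk gk fg; pose h w := Num.max (f w) (g w).
have hk : past_determined k h by move=> w w' ww'; rewrite /h (fk _ _ ww') (gk _ _ ww').
have -> : ('E_P[g] = 'E_P[h])%E.
  rewrite unlock; apply: ae_eq_integral => //.
  - apply/measurable_EFinP; exact: (past_determined_measurable_fun gk).
  - apply/measurable_EFinP; exact: (past_determined_measurable_fun hk).
  - by apply: filterS fg => w fgw _; rewrite /h max_r.
rewrite unlock; apply: le_integral => //.
- exact: past_determined_integrable fk.
- exact: past_determined_integrable hk.
- by move=> w _; rewrite lee_fin /h le_max lexx.
Qed.

Lemma expectation_scale k (f : T -> R) (c : R) : past_determined k f ->
  ('E_P[fun w => (f w * c)%R] = 'E_P[f] * c%:E)%E.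
Proof.
move=> fk; rewrite unlock -integralZr //; last exact: past_determined_integrable fk.
Qed.

Lemma past_determined_indic k w :
  past_determined k (\1_(past I k w) : T -> R).
Proof.
move=> v v' vv'; rewrite !indicE; congr (_%:R); congr nat_of_bool.
apply/idP/idP; rewrite !inE => wv j jk; last by rewrite vv' ?wv.
by rewrite -wv // vv'.
Qed.

Lemma past_determined_cond_expectation k (Y : T -> R) :
  past_determined k (cond_expectation P I k Y).
Proof. by move=> w w' ww'; rewrite /cond_expectation (past_eq ww'). Qed.

(** On the atom of [w] the bound [g] is constant, equal to [g w]. *)
Lemma cond_expectation_le k (f g : T -> R) :
  past_determined k.+1 f -> past_determined k g ->
  (forall w, 0 <= f w) -> {ae P, forall w, f w <= g w} ->
  {ae P, forall w, (cond_expectation P I k f w <= (g w)%:E)%E}.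
Proof.
move=> fk gk f0 fg; apply: filterS (fg) => w fgw.
have gw0 : 0 <= g w := le_trans (f0 w) fgw.
have mw := measurable_past k w.
have indk : past_determined k (\1_(past I k w) : T -> R) by exact: past_determined_indic.
have indkS := past_determined_le (leqnSn k) indk.
have pfin : P (past I k w) \is a fin_num by exact: fin_num_measure.
set c := fine (P (past I k w)).
have c0 : 0 <= c by rewrite fine_ge0.
have le1 : ('E_P[fun w' => (f w' * \1_(past I k w) w')%R] <= (c * g w)%:E)%E.
  apply: le_trans (_ : _ <= 'E_P[fun w' => (\1_(past I k w) w' * g w)%R])%E _.
    apply: (@expectation_le_ae k.+1).
    - by move=> v v' vv'; rewrite (fk _ _ vv') (indkS _ _ vv').
    - by move=> v v' vv'; rewrite (indkS _ _ vv').
    - apply: filterS fg => v fgv; rewrite indicE mulrC.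
      have [/set_mem wv|_] := boolP (v \in past I k w); last by rewrite !mul0r.
      by rewrite !mul1r -(gk _ _ wv).
  by rewrite (expectation_scale _ indk) expectation_indic // -(fineK pfin) EFinM.
rewrite /cond_expectation -/c.
apply: le_trans (lee_wpmul2r _ le1) _; first by rewrite lee_fin invr_ge0.
rewrite -EFinM lee_fin mulrAC.
have [->|cn0] := eqVneq c 0; first by rewrite mul0r mul0r.
by rewrite mulfV // mul1r.
Qed.

(** An atom of probability zero gives a zero conditional expectation by the
convention [0^-1 = 0], but then the conclusion is trivial. *)
Lemma cond_expectation_indic_eq0 k i w :
  cond_expectation P I k \1_(I k @^-1` [set i]) w = 0%E ->
  P (past I k w `&` I k @^-1` [set i]) = 0%E.
Proof.
have mw := measurable_past k w; have mwi := measurableI _ _ mw (measI k i).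
rewrite /cond_expectation => h.
have EE : ('E_P[fun w' => (\1_(I k @^-1` [set i]) w' * \1_(past I k w) w')%R]
    = P (past I k w `&` I k @^-1` [set i]))%E.
  rewrite -(expectation_indic P mwi); congr expectation; apply/funext => v.
  by rewrite indicI /= mulrC.
rewrite EE in h.
have pfin : P (past I k w) \is a fin_num by exact: fin_num_measure.
have [c0|c0] := eqVneq (P (past I k w)) 0%E.
  apply/eqP; rewrite eq_le measure_ge0 andbT -c0.
  by apply: le_measure; rewrite ?inE.
move/eqP: h; rewrite mule_eq0 => /orP [/eqP //|].
by rewrite eqe invr_eq0 fine_eq0 // (negPf c0).
Qed.

Lemma ae_point (Q : T -> Prop) : {ae P, forall w, Q w} -> exists w, Q w.
Proof.
move=> aeQ; apply: contrapT => noQ.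
have : P.-negligible [set: T].
  by apply: negligibleS aeQ => w _ /= Qw; apply: noQ; exists w.
move=> /(negligibleP _ measurableT) PT0; have : P setT = 0%E := PT0.
by rewrite probability_setT => /eqP; rewrite eqe oner_eq0.
Qed.

Lemma cvg_expectation_geometric (e : nat -> T -> R) (rho : R) :
  0 <= rho < 1 -> (forall k, past_determined k (e k)) ->
  (forall k w, 0 <= e k w) -> (exists c, forall w, e 0%N w = c) ->
  (forall k, {ae P, forall w, e k.+1 w <= rho * e k w}) ->
  'E_P[e k]%E @[k --> \oo] --> 0%E.
Proof.
move=> /andP [rho0 rho1] ek e_ge0 [c e0] edec.
have bound k : ('E_P[e k] <= (c * rho ^+ k)%:E)%E.
  rewrite -(expectation_cst P); apply: (@expectation_le_ae k) => //.
  apply: filterS (ae_foralln edec) => w dec.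
  elim: k => [|k IHk]; first by rewrite /= e0 expr0 mulr1.
  rewrite exprS mulrCA; apply: le_trans (dec k) _.
  by rewrite ler_wpM2l.
apply: (@squeeze_cvge _ _ _ _ (fun=> 0%E) _ (fun k => (c * rho ^+ k)%:E)).
- by near=> k; rewrite bound andbT expectation_ge0.
- exact: cvg_cst.
- apply/cvg_EFin; first by near=> k.
  by apply: cvg_geometric; rewrite ger0_norm.
Unshelve. all: by end_near. Qed.

End FiniteHistory.
(** * The random iteration *)

Section Iteration.
Context {R : realType} {m p q n : nat}.
Variables (A : 'M[R]_(m, p)) (B : 'M[R]_(q, n)) (C : 'M[R]_(m, n)).
Variables (theta alpha : R) (X0 : 'M[R]_(p, q)).
Context {d : measure_display} {T : measurableType d}.
Variables (P : probability T R) (I : nat -> T -> 'I_m).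
Let X := iterate alpha A B C X0 I.
Let Res := residual alpha A B C X0 I.

Lemma rgrbk_state_past k (s s' : nat -> 'I_m) :
  (forall j, (j < k)%N -> s' j = s j) ->
  rgrbk_state alpha A B C X0 s' k = rgrbk_state alpha A B C X0 s k.
Proof.
elim: k => //= k IHk ss'; rewrite IHk ?ss' // => j jk; apply: ss'.
exact: ltnW.
Qed.

Lemma iterate_past k : past_determined I k (X k).
Proof. by move=> w w' ww'; rewrite /X /iterate (rgrbk_state_past ww'). Qed.

Lemma residual_past k : past_determined I k (Res k).
Proof. by move=> w w' ww'; rewrite /Res /residual (rgrbk_state_past ww'). Qed.

Lemma iterateS k w : X k.+1 w = kaczmarz_update A B alpha (X k w) (Res k w) (I k w).
Proof. by rewrite /X /Res /iterate /residual /=; case: rgrbk_state. Qed.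

Lemma residualE k w : Res k w = C - A *m X k w *m B.
Proof.
rewrite /X /Res /iterate /residual; elim: k => //= k; case: rgrbk_state => /= Y S ->.
rewrite mulmxDr mulmxDl opprD addrA; congr (_ - _).
by rewrite -scalemxAr -scalemxAl !mulmxA.
Qed.

Lemma residual_error Y k w : is_solution A B C Y -> Res k w = A *m (Y - X k w) *m B.
Proof. by move=> YC; rewrite residualE mulmxBr mulmxBl YC. Qed.

(** Each update adds a matrix of the form [A^T W B^T]. *)
Lemma iterate_error_in_space Y k w : in_row_col_space A B (X0 - Y) ->
  in_row_col_space A B (X k w - Y).
Proof.
move=> X0Y; elim: k => // k IHk; rewrite iterateS /kaczmarz_update addrAC.
apply: in_row_col_spaceD => //; apply: in_row_col_spaceZ.
rewrite rowE trmx_mul mulmxA -(mulmxA A^T).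
exact: in_row_col_space_mul.
Qed.

Hypothesis selP : rgrbk_selection P theta alpha A B C X0 I.

(** The histories on which a row of zero probability is selected, and the
selection rule holds exactly, form null atoms; there are finitely many. *)
Lemma ae_greedy k : {ae P, forall w, greedy_rows theta A (Res k w) (I k w)}.
Proof.
have [measI sel] := selP.
pose S := [set w | ~~ greedy_rows theta A (Res k w) (I k w) /\
  cond_expectation P I k \1_(I k @^-1` [set I k w]) w
  = (selection_prob theta A (Res k w) (I k w))%:E].
have Sneg : P.-negligible S.
  apply: (@past_determined_negligible _ _ _ _ _ _ measI k.+1).
    move=> w w' ww'; have ww'k := past_le (leqnSn k) ww'.
    rewrite /S /= (residual_past ww'k) (ww' k) //.
    by rewrite (past_determined_cond_expectation _ _ ww'k).
  move=> w [ngreedy eqw]; rewrite pastS.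
  apply: cond_expectation_indic_eq0 => //; rewrite eqw.
  rewrite /selection_prob (_ : row _ _ = 0) ?frobenius_sqr; last first.
    by apply/rowP => j; rewrite !mxE (negPf ngreedy).
  by rewrite /fdot mulmx0 mxtrace0 mul0r.
have aeS : {ae P, forall w, ~ S w}.
  by apply: negligibleS Sneg => w /= /contrapT.
apply: filterS2 aeS (filter_forall _ (sel k)) => w nS selw.
by apply: contrapT => /negP ng; apply: nS; split.
Qed.

Hypothesis rowA : forall i : 'I_m, row i A != 0.
Hypothesis theta01 : 0 <= theta <= 1.
Hypothesis alphaP : 0 < alpha < 2 / spectral_norm B ^+ 2.
Hypothesis notconst : forall k : nat, {ae P, forall w,
  ~ (forall i j : 'I_m, row_ratio A (Res k w) i = row_ratio A (Res k w) j)}.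

Lemma matrix_neq0 : A != 0.
Proof.
have [w _] := ae_point (notconst 0); have := rowA (I 0 w).
by apply: contraNneq => ->; rewrite row0.
Qed.

Section Error.
Variable Y : 'M[R]_(p, q).
Hypothesis YC : is_solution A B C Y.
Hypothesis X0Y : in_row_col_space A B (X0 - Y).
Let err k w := frobenius (X k w - Y) ^+ 2.
Let dstep k w := delta_step theta alpha A B (Res k w).

Lemma err_past k : past_determined I k (err k).
Proof. by move=> w w' ww'; rewrite /err (iterate_past ww'). Qed.

Lemma delta_step_past k : past_determined I k (dstep k).
Proof. by move=> w w' ww'; rewrite /dstep (residual_past ww'). Qed.

Lemma ae_error_uniform k :
  {ae P, forall w, err k.+1 w <= uniform_rate A B alpha * err k w}.
Proof.
apply: filterS2 (ae_greedy k) (notconst k) => w greedy nc.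
rewrite /err iterateS !frobenius_sqr.
apply: (greedy_step_uniform rowA alphaP theta01) greedy => //.
  exact: residual_error.
exact: iterate_error_in_space.
Qed.

Lemma ae_error_delta k : {ae P, forall w,
  [/\ err k.+1 w <= dstep k w * err k w,
      dstep k w * err k w <= delta alpha A B * err k w & 0 < err k w]}.
Proof.
apply: filterS2 (ae_greedy k) (notconst k) => w greedy nc.
have RkE := residual_error k w YC.
have supp := iterate_error_in_space k w X0Y.
rewrite /err iterateS !frobenius_sqr; split.
- exact: (greedy_step_delta rowA alphaP theta01 RkE nc supp greedy).
- exact: delta_step_error_le.
- exact: (error_gt0 RkE nc).
Qed.

Lemma error_cvg : cvg_in_expectation P X Y.
Proof.
have [measI _] := selP.
apply: (cvg_expectation_geometric measI (rho := uniform_rate A B alpha)).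
- by rewrite uniform_rate_ge0 // uniform_rate_lt1 // matrix_neq0.
- exact: err_past.
- by move=> k w; exact: sqr_ge0.
- by exists (frobenius (X0 - Y) ^+ 2).
- exact: ae_error_uniform.
Qed.

(** Since the error at step [l] is positive, the one-step inequalities can be
divided by it, which gives [0 <= dstep l w <= delta]. *)
Lemma ae_product_bounds k : {ae P, forall w,
  err k.+1 w <= (\prod_(l < k.+1) dstep l w) * frobenius (X0 - Y) ^+ 2 /\
  \prod_(l < k.+1) dstep l w <= delta alpha A B ^+ k.+1}.
Proof.
apply: filterS (ae_foralln ae_error_delta) => w dec.
have dstep_ge0 l : 0 <= dstep l w.
  have [h _ e_gt0] := dec l; rewrite -(pmulr_lge0 _ e_gt0).
  by apply: le_trans h; exact: sqr_ge0.
have dstep_le l : dstep l w <= delta alpha A B.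
  by have [_ h e_gt0] := dec l; rewrite -(ler_pM2r e_gt0).
split.
  elim: k => [|k IHk].
    by rewrite big_ord1; have [] := dec 0.
  have [h _ _] := dec k.+1; apply: le_trans h _.
  by rewrite big_ord_recr /= [leRHS]mulrAC [leRHS]mulrC ler_wpM2l.
apply: le_trans (_ : \prod_(l < k.+1) delta alpha A B <= _).
  by apply: ler_prod => l _; rewrite dstep_ge0 dstep_le.
by rewrite prodr_const card_ord.
Qed.

End Error.
End Iteration.

(** * Convergence of the method *)

Theorem theorem4p3 (R : realType) (m p q n : nat)
    (A : 'M[R]_(m, p)) (B : 'M[R]_(q, n)) (C : 'M[R]_(m, n))
    (theta alpha : R) (X0 : 'M[R]_(p, q))
    (d : measure_display) (T : measurableType d) (P : probability T R)
    (I : nat -> T -> 'I_m) :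
  let X := iterate alpha A B C X0 I in
  let Res := residual alpha A B C X0 I in
  (forall i : 'I_m, row i A != 0) ->
  (exists Y : 'M[R]_(p, q), is_solution A B C Y) ->
  0 <= theta <= 1 ->
  0 < alpha < 2 / spectral_norm B ^+ 2 ->
  rgrbk_selection P theta alpha A B C X0 I ->
  (forall k : nat, {ae P, forall w,
     ~ (forall i j : 'I_m, row_ratio A (Res k w) i = row_ratio A (Res k w) j)}) ->
  (exists2 Y : 'M[R]_(p, q),
     is_solution A B C Y & cvg_in_expectation P X Y) /\
  (range_sub X0 A^T -> range_sub X0^T B ->
   let Xs := mp_pinv A *m C *m mp_pinv B in
   [/\ unique_min_norm_solution A B C Xs,
       cvg_in_expectation P X Xs,
       forall k : nat, {ae P, forall w,
         (cond_expectation P I k (fun w' => (frobenius (X k.+1 w' - Xs) ^+ 2)%R) w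
          <= (delta_step theta alpha A B (Res k w)
              * frobenius (X k w - Xs) ^+ 2)%:E)%E /\
         delta_step theta alpha A B (Res k w) * frobenius (X k w - Xs) ^+ 2
         <= delta alpha A B * frobenius (X k w - Xs) ^+ 2} &
       forall k : nat,
         ('E_P[fun w => (frobenius (X k.+1 w - Xs) ^+ 2)%R]
          <= 'E_P[fun w => (\prod_(l < k.+1) delta_step theta alpha A B (Res l w))%R]
             * (frobenius (X0 - Xs) ^+ 2)%:E)%E /\
         ('E_P[fun w => (\prod_(l < k.+1) delta_step theta alpha A B (Res l w))%R]
             * (frobenius (X0 - Xs) ^+ 2)%:E
          <= (delta alpha A B ^+ k.+1 * frobenius (X0 - Xs) ^+ 2)%:E)%E]).
Proof.
move=> X Res rowA [Y0 Y0C] theta01 alphaP selP notconst.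
have [measI _] := selP.
set Xs := mp_pinv A *m C *m mp_pinv B.
have XsC : is_solution A B C Xs := mp_pinv_solution Y0C.
have XsS : in_row_col_space A B Xs := mp_pinv_in_row_col_space Y0C.
split.
  have [AGA _ _ _] := mp_pinvP A; have [BGB _ _ _] := mp_pinvP B.
  (* Z is the projection of X0, so X0 - Z is what no update can change. *)
  pose Z := mp_pinv A *m (A *m X0 *m B) *m mp_pinv B.
  have ZE : A *m Z *m B = A *m X0 *m B.
    by rewrite /Z !mulmxA AGA -!mulmxA (mulmxA B) BGB.
  have YC : is_solution A B C (Xs + (X0 - Z)).
    by rewrite /is_solution mulmxDr mulmxDl XsC mulmxBr mulmxBl ZE subrr addr0.
  exists (Xs + (X0 - Z)) => //.
  apply: (error_cvg selP rowA theta01 alphaP notconst YC).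
  have -> : X0 - (Xs + (X0 - Z)) = Z + (- 1) *: Xs.
    by rewrite scaleN1r opprD opprB addrCA subrKC addrC.
  apply: in_row_col_spaceD; last exact: in_row_col_spaceZ.
  by rewrite /in_row_col_space ZE.
move=> X0A X0B; have X0S := range_sub_in_row_col_space X0A X0B.
have X0Xs : in_row_col_space A B (X0 - Xs).
  by rewrite -scaleN1r; apply: in_row_col_spaceD => //; exact: in_row_col_spaceZ.
have err_det k := @err_past _ _ _ _ _ A B C alpha X0 _ T I Xs k.
have dstep_det k := @delta_step_past _ _ _ _ _ A B C theta alpha X0 _ T I k.
have err_delta := ae_error_delta selP rowA theta01 alphaP notconst XsC X0Xs.
split.
- exact: mp_pinv_unique_min_norm Y0C.
- exact: (error_cvg selP rowA theta01 alphaP notconst XsC X0Xs).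
- move=> k.
  have rhs_det : past_determined I k (fun w => delta_step theta alpha A B (Res k w)
      * frobenius (X k w - Xs) ^+ 2).
    by move=> w w' ww'; rewrite (err_det k _ _ ww') (dstep_det k _ _ ww').
  have ce : {ae P, forall w, (cond_expectation P I k
      (fun w' => (frobenius (X k.+1 w' - Xs) ^+ 2)%R) w
      <= (delta_step theta alpha A B (Res k w)
          * frobenius (X k w - Xs) ^+ 2)%:E)%E}.
    apply: (cond_expectation_le measI (err_det k.+1) rhs_det).
      by move=> w; exact: sqr_ge0.
    by apply: filterS (err_delta k) => w [].
  by apply: filterS2 ce (err_delta k) => w ? [].
- move=> k.
  have prod_det : past_determined I k.+1
      (fun w => \prod_(l < k.+1) delta_step theta alpha A B (Res l w)).
    move=> w w' ww'; apply: eq_bigr => l _.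
    exact: (past_determined_le (ltnW (ltn_ord l)) (dstep_det l)) ww'.
  have bounds := ae_product_bounds selP rowA theta01 alphaP notconst XsC X0Xs k.
  rewrite -(expectation_scale P measI _ prod_det); split.
    apply: (expectation_le_ae measI (err_det k.+1)).
      by move=> w w' ww'; rewrite (prod_det _ _ ww').
    by apply: filterS bounds => w [].
  rewrite -(expectation_cst P); apply: (@expectation_le_ae _ _ _ _ _ _ measI k.+1) => //.
    by move=> w w' ww'; rewrite (prod_det _ _ ww').
  by apply: filterS bounds => w [_ h]; rewrite ler_wpM2r ?sqr_ge0.
Qed.
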